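(* Let $\mathfrak{M}$ be a von Neumann algebra and let $A\in\mathfrak{M}$ be a nonzero positive well-supported element. Two elements $S,T\in\mathfrak{M}^A$ satisfy $\sigma_A(SX)=\sigma_A(TX)$ for all $X\in\mathfrak{M}^A$ if and only if $AS=AT$.
   Context: $\mathfrak{M}$ acts on a complex Hilbert space $\mathcal{H}$ and contains the identity $I$. The positive element $A$ is called well-supported if $\sigma(A)\setminus\{0\}$ is closed, equivalently $\sigma(A)\subseteq\{0\}\cup[\alpha,\infty)$ for some $\alpha>0$. For $h\in\mathcal{H}$ put $\|h\|_A=\sqrt{\langle Ah,h\rangle}$, for $T\in\mathfrak{M}$ put $\|T\|_A=\sup\{\|Th\|_A:\|h\|_A=1\}$, and set $\mathfrak{M}^A=\{T\in\mathfrak{M}:\|T\|_A<\infty\}$ (a subalgebra of $\mathfrak{M}$). $T\in\mathfrak{M}^A$ is $A$-invertible in $\mathfrak{M}^A$ if there is $S\in\mathfrak{M}^A$ with $ATS=AST=A$; the $A$-spectrum is $\sigma_A(T)=\{\lambda\in\mathbb{C}:\lambda I-T\text{ is not }A\text{-invertible in }\mathfrak{M}^A\}$. *)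

(* Defs.v *)
From HB Require Import structures.
From mathcomp Require Import all_boot all_order all_algebra.
From mathcomp Require Import all_classical all_reals all_analysis.
From mathcomp Require Import complex.

Set Implicit Arguments.
Unset Strict Implicit.
Unset Printing Implicit Defensive.

Import Order.TTheory GRing.Theory Num.Theory Num.Def.
Import numFieldNormedType.Exports.

Local Open Scope ring_scope.
Local Open Scope classical_set_scope.

Section Definitions.
Context {R : realType} {H : completeNormedModType R[i]}.

(* [dot] is linear in its first argument and conjugate linear in the second;
   together with the completeness of [H] this makes [H] a Hilbert space. *)
Definition hilbert_dot (dot : {dot H for conjC}) : Prop :=
  forall h : H, `|h| ^+ 2 = dot h h.

(* Operators are bare functions, so that equality, sums and scalings are the
   pointwise ones and the product [S T] is [S \o T]. *)
Definition bounded_operator (T : H -> H) : Prop := linear T /\ continuous T.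

Variable dot : {dot H for conjC}.

Definition is_adjoint (T T' : H -> H) : Prop :=
  forall h k : H, dot (T h) k = dot h (T' k).

(* A filter of operators is used as a generalized sequence (net). *)
Definition wot_cvg_to (F : set_system (H -> H)) (T : H -> H) : Prop :=
  forall h k : H,
    (fun S : H -> H => dot (S h) k : R[i]^o) @ F --> (dot (T h) k : R[i]^o).

Definition wot_closed (M : set (H -> H)) : Prop :=
  forall (F : set_system (H -> H)) (T : H -> H),
    ProperFilter F -> F M -> bounded_operator T -> wot_cvg_to F T -> M T.

(* A *-subalgebra of the bounded operators on [H] which contains the identity
   and is closed in the weak operator topology. *)
Record von_neumann_algebra (M : set (H -> H)) : Prop := VonNeumannAlgebra {
  vna_bounded : forall T, M T -> bounded_operator T ;
  vna_id : M idfun ;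
  vna_add : forall S T, M S -> M T -> M (S + T) ;
  vna_scale : forall (a : R[i]) T, M T -> M (a *: T) ;
  vna_comp : forall S T, M S -> M T -> M (S \o T) ;
  vna_adjoint : forall T, M T -> exists2 T', M T' & is_adjoint T T' ;
  vna_wot_closed : wot_closed M
}.

(* The order of [R[i]] makes this say that [dot (A h) h] is real and
   nonnegative. *)
Definition positive_operator (A : H -> H) : Prop :=
  forall h : H, 0 <= dot (A h) h.

Variable M : set (H -> H).

Definition invertible_in (T : H -> H) : Prop :=
  exists2 S, M S & T \o S = idfun /\ S \o T = idfun.

Definition spectrum (T : H -> H) : set R[i] :=
  [set l : R[i] | ~ invertible_in (l *: idfun - T)].

Definition well_supported (A : H -> H) : Prop :=
  closed (spectrum A `\ 0 : set R[i]^o).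

Variable A : H -> H.

Definition A_seminorm (h : H) : R := Num.sqrt (complex.Re (dot (A h) h)).

(* Extended-real valued, [+oo] when the supremum is infinite. *)
Definition A_opnorm (T : H -> H) : \bar R :=
  ereal_sup [set (A_seminorm (T h))%:E | h in [set h : H | A_seminorm h = 1]].

Definition A_bounded : set (H -> H) :=
  [set T | M T /\ (A_opnorm T < +oo)%E].

Definition A_invertible (T : H -> H) : Prop :=
  exists2 S, A_bounded S & A \o T \o S = A /\ A \o S \o T = A.

Definition A_spectrum (T : H -> H) : set R[i] :=
  [set l : R[i] | ~ A_invertible (l *: idfun - T)].

End Definitions.

(* Main.v *)
Require Import Defs.
From HB Require Import structures.
From mathcomp Require Import all_boot all_order all_algebra.
From mathcomp Require Import all_classical all_reals all_analysis.
From mathcomp Require Import complex.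
From mathcomp Require Import ring lra.
Import Order.TTheory GRing.Theory Num.Theory Num.Def.
Import numFieldNormedType.Exports.
Local Open Scope ring_scope.
Local Open Scope classical_set_scope.

(** Call two elements of the algebra [N] of [A]-bounded operators congruent when
    they agree after composition with [A] on the left.  Elements of [N] preserve
    the kernel of [A], so congruence is compatible with products, and being
    [A]-invertible means being a unit of the quotient ring.  Congruent operators
    thus have the same [A]-spectrum, which is the easy direction.

    For the converse, put [D = S - T].  The hypothesis, used at the single
    spectral value [1], says that [1 + S u] and [1 + T u] are invertible for the
    same [u] in [N].  If [v] is an inverse of [1 + S u], then [1 - S u v = v] is
    invertible, so [- u v] is again such an element; applying the hypothesis to
    it and multiplying back by [1 + S u] shows that [1 + (S - T) u] is
    invertible.  Iterating, [1 + S u] invertible implies [1 - n D u] invertible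
    for every natural number [n] ([stays_invertible_iter]).

    Now take [u = t D' A] with [D'] the adjoint of [D].  Whatever [S] is,
    [1 + S u] is invertible for small [t], by a Neumann series whose sum stays
    in the von Neumann algebra ([neumann_series], [A_invertible_small]).  With
    [n t = 1 / m] it follows that [1 - m^-1 D D' A] is [A]-invertible for every
    [m > 0] ([A_invertible_positive_resolvent]).  But [D D' A] is a positive
    operator for the semi-inner product [<A h, k>], with quadratic form
    [|D' A h| ^ 2], and the norm of a nonzero positive operator belongs to its
    spectrum.  So [D' A = 0], that is [A D = 0] ([positive_resolvent_eq0]).

    The fact about the norm is proved without spectral theory: for a positive
    operator [C], the form [<C h, h>] dominates a multiple of [|C h| ^ 2]
    ([positive_symmetric_n2]), so it also dominates a multiple of [|h| ^ 2] as
    soon as [C] is bounded below, and the best constant in an inequality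
    [p <= m q] of quadratic forms cannot be attained with such a gap
    ([no_least_constant_le0]).  The same principle shows that [A] being
    well-supported gives [a <A h, h> <= |A h| ^ 2] for some [a > 0]
    ([well_supported_gap]).  Up to constants the seminorm of [h] is then
    [|A h|], which is how [A]-boundedness becomes tractable ([A_boundedP]). *)

Set Implicit Arguments.
Unset Strict Implicit.
Unset Printing Implicit Defensive.

(** * A variational principle *)

Section VariationalPrinciple.
Context {R : realType} {I : Type}.

(** If [p] is positive somewhere, the least [m] with [p <= m q] exists and is
    positive; a gap [e] at this [m] would make [m - e] a smaller constant. *)
Lemma no_least_constant_le0 (p q : I -> R) (c : R) :
  (forall x, 0 <= q x) -> (forall x, p x <= c * q x) ->
  (forall m, 0 < m -> (forall x, p x <= m * q x) ->
     exists2 e, 0 < e & forall x, e * q x <= m * q x - p x) ->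
  forall x, p x <= 0.
Proof.
move=> q0 pc gap x; rewrite leNgt; apply/negP => px.
have qx : 0 < q x.
  by rewrite lt_def q0 andbT; apply/eqP => qx0; move: (pc x); rewrite qx0; lra.
pose E := [set m | forall y, p y <= m * q y].
have lbE : lbound E (p x / q x) by move=> m /(_ x) pm; rewrite ler_pdivrMr.
have Einf : has_inf E by split; [exists c | exists (p x / q x)].
have m0 : 0 < inf E.
  apply: (lt_le_trans (divr_gt0 px qx)).
  by apply: lb_le_inf => //; exists c.
have Em : E (inf E).
  move=> y; have [qy0|qy] := eqVneq (q y) 0.
    by move: (pc y); rewrite qy0 !mulr0.
  have {}qy : 0 < q y by rewrite lt_def qy q0.
  rewrite -ler_pdivrMr//; apply: lb_le_inf; first by exists c.
  by move=> m /(_ y) pm; rewrite ler_pdivrMr.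
have [e e0 He] := gap _ m0 Em.
have : E (inf E - e) by move=> y; have := He y; rewrite mulrBl; lra.
move=> /(ge_inf Einf.2); lra.
Qed.

End VariationalPrinciple.

(** * The real part of the inner product *)

Section RealInnerProduct.
Context {R : realType} {H : completeNormedModType R[i]}.
Variable dot : {dot H for conjC}.

(** The real part already determines the norm and makes [H] a real inner product
    space, so that the estimates take place in the totally ordered field [R]
    instead of [R[i]]. *)
Definition ip (h k : H) : R := complex.Re (dot h k).

Local Notation n2 h := (ip h h).
Local Notation "r *r h" := (real_complex R r *: h) (at level 40).

Lemma ipDl h k l : ip (h + k) l = ip h l + ip k l.
Proof. by rewrite /ip linearDl raddfD. Qed.

Lemma ipZl r h k : ip (r *r h) k = r * ip h k.
Proof.
by rewrite /ip linearZl_LR /=; case: (dot h k) => a b /=; rewrite mul0r subr0.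
Qed.

Lemma ipC h k : ip h k = ip k h.
Proof.
rewrite /ip hermC /= expr0 mul1r; by case: (dot k h).
Qed.

Lemma ipNl h k : ip (- h) k = - ip h k.
Proof. by rewrite /ip linearNl raddfN. Qed.

Lemma ipBl h k l : ip (h - k) l = ip h l - ip k l.
Proof. by rewrite ipDl ipNl. Qed.

Lemma ipDr h k l : ip l (h + k) = ip l h + ip l k.
Proof. by rewrite ipC ipDl !(ipC l). Qed.

Lemma ipZr r h k : ip h (r *r k) = r * ip h k.
Proof. by rewrite ipC ipZl ipC. Qed.

Lemma ipNr h k : ip h (- k) = - ip h k.
Proof. by rewrite ipC ipNl ipC. Qed.

Lemma ipBr h k l : ip l (h - k) = ip l h - ip l k.
Proof. by rewrite ipDr ipNr. Qed.

Lemma ip0l h : ip 0 h = 0.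
Proof. by rewrite /ip linear0l. Qed.

Lemma ip_ge0 h : 0 <= n2 h.
Proof. by have := dnorm_ge0 dot h; rewrite lecE => /andP[_]. Qed.

Lemma ip_eq0 h : n2 h = 0 -> h = 0.
Proof.
move=> h0; apply/eqP/negPn/negP => /(neq0_dnorm_gt0 (s := dot)).
by rewrite ltcE => /andP[_]; rewrite -/(ip h h) h0 ltxx.
Qed.

Lemma ip_le_mean h k : 2 * ip h k <= n2 h + n2 k.
Proof. by have := ip_ge0 (h - k); rewrite !ipBl !ipBr (ipC k h); lra. Qed.

Lemma n2_scale a (h : H) :
  n2 (a *: h) = (complex.Re a ^+ 2 + complex.Im a ^+ 2) * n2 h.
Proof.
rewrite /ip linearZl_LR /= linearZr_LR/=.
case: (dot h h) a => x y [u v] /=; ring.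
Qed.

Lemma ip_sqr_le h k : ip h k ^+ 2 <= n2 h * n2 k.
Proof.
have [k0|k0] := eqVneq (n2 k) 0.
  by rewrite (ip_eq0 k0) ipC !ip0l expr0n mulr0.
have {}k0 : 0 < n2 k by rewrite lt_def k0 ip_ge0.
have := ip_ge0 (n2 k *r h - ip h k *r k).
rewrite !(ipBl, ipBr, ipZl, ipZr) (ipC k h) => P.
rewrite -(ler_pM2l k0); nra.
Qed.

Hypothesis hH : hilbert_dot dot.

Lemma normC_sqr h : `|h| ^+ 2 = real_complex R (n2 h).
Proof.
by rewrite hH /ip RRe_real// realE dnorm_ge0.
Qed.

Lemma le_normC (r : R) h k : 0 <= r ->
  (n2 h <= r ^+ 2 * n2 k) = (`|h| <= real_complex R r * `|k|).
Proof.
move=> r0.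
rewrite -[RHS](@ler_pXn2r _ 2)// ?nnegrE ?mulr_ge0 ?ler0c//.
rewrite exprMn !normC_sqr.
by rewrite -rmorphXn -rmorphM lecR.
Qed.

End RealInnerProduct.

(** * Invertibility modulo a left factor *)

Section LinearFunctions.
Context {K : nzRingType} {V : lmodType K}.

Lemma linear_bundle (T : V -> V) : linear T -> exists F : {linear V -> V}, T = F.
Proof.
move=> lT.
pose F := HB.pack_for {linear V -> V} T (GRing.isLinear.Build _ _ _ _ T lT).
by exists F.
Qed.

Lemma linear_rules (T : V -> V) : linear T ->
  [/\ {morph T : h k / h + k}, {morph T : h / - h},
      forall a, {morph T : h / a *: h} & T 0 = 0].
Proof.
move=> /linear_bundle[F ->]; split; [exact: linearD | exact: linearN | |].
  by move=> a h; rewrite linearZ.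
exact: linear0.
Qed.

End LinearFunctions.

Section InvertibilityModulo.
Context {K : comNzRingType} {V : lmodType K}.
Variables (A : V -> V) (N : set (V -> V)).

(** When every element of [N] preserves the kernel of [A], these are the
    representatives of the units of the quotient of [N] by the two-sided ideal
    of the [X] with [A X = 0]. *)
Definition invertible_mod (T : V -> V) : Prop :=
  exists2 S, N S & A \o T \o S = A /\ A \o S \o T = A.

Hypothesis linA : linear A.
Hypothesis linN : forall X, N X -> linear X.
Hypothesis N1 : N idfun.
Hypothesis ND : forall X Y, N X -> N Y -> N (X + Y).
Hypothesis NZ : forall a X, N X -> N (a *: X).
Hypothesis NM : forall X Y, N X -> N Y -> N (X \o Y).
Hypothesis Nker : forall X h, N X -> A h = 0 -> A (X h) = 0.

Lemma N_opp X : N X -> N (- X).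
Proof. by move=> NX; rewrite -scaleN1r; exact: NZ. Qed.

Lemma comp_mod Z h k : N Z -> A h = A k -> A (Z h) = A (Z k).
Proof.
move=> NZ' hk; apply/eqP; rewrite -subr_eq0; apply/eqP.
have [ZD ZN _ _] := linear_rules (linN NZ').
have [AD AN _ _] := linear_rules linA.
by rewrite -AN -AD -ZN -ZD Nker// AD AN hk subrr.
Qed.

Lemma eq_invertible_mod X Y : (forall h, A (X h) = A (Y h)) ->
  invertible_mod X -> invertible_mod Y.
Proof.
move=> XY [S NS [XS SX]]; exists S => //; split; apply/funext => h /=.
  by rewrite -XY -[RHS](congr1 (@^~ h) XS).
by rewrite -[RHS](congr1 (@^~ h) SX)/=; exact/comp_mod.
Qed.

Lemma invertible_modM X Y : N X -> N Y ->
  invertible_mod X -> invertible_mod Y -> invertible_mod (X \o Y).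
Proof.
move=> NX NY [X' NX' [XX' X'X]] [Y' NY' [YY' Y'Y]].
exists (Y' \o X'); first exact: NM.
split; apply/funext => h /=.
  rewrite -[RHS](congr1 (@^~ h) XX')/=; apply: comp_mod => //.
  exact: (congr1 (@^~ (X' h)) YY').
rewrite -[RHS](congr1 (@^~ h) Y'Y)/=; apply: comp_mod => //.
exact: (congr1 (@^~ (Y h)) X'X).
Qed.

Definition stays_invertible (S w : V -> V) : Prop :=
  forall u, N u -> invertible_mod (idfun + (S \o u)) ->
    invertible_mod (idfun + (w \o u)).

(** With [v] inverse to [1 + S u] one has [1 - S u v = v], so that
    [- u v] is again admissible, and
    [1 + (S - w) u = (1 - w u v) (1 + S u)]. *)
Lemma stays_invertible_sub S w : N S -> N w ->
  stays_invertible S w -> stays_invertible S (S - w).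
Proof.
move=> NS Nw Sw u Nu Su; have [v Nv [Suv vSu]] := Su.
have [AD AN _ _] := linear_rules linA.
have [SD SN _ _] := linear_rules (linN NS).
have [wD wN _ _] := linear_rules (linN Nw).
have N1Su : N (idfun + (S \o u)) by apply: ND => //; exact: NM.
have Suv' h : A (v h) + A (S (u (v h))) = A h.
  by rewrite -AD; exact: (congr1 (@^~ h) Suv).
have vSu' h : A (v (h + S (u h))) = A h by exact: (congr1 (@^~ h) vSu).
pose u' := - (u \o v).
have Nu' : N u' by apply/N_opp/NM.
have Nwu' : N (idfun + (w \o u')) by apply: ND => //; exact: NM.
have iw : invertible_mod (idfun + (w \o u')).
  apply: Sw => //; apply: (@eq_invertible_mod v); last first.
    by exists (idfun + (S \o u)).
  move=> h; rewrite -[RHS]/(A (h + S (- u (v h)))) SN AD AN -(Suv' h).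
  by rewrite addrK.
apply: eq_invertible_mod (invertible_modM Nwu' N1Su iw Su) => h.
rewrite -[LHS]/(A (h + S (u h) + w (- u (v (h + S (u h)))))).
rewrite -[RHS]/(A (h + (S (u h) - w (u h)))) addrA wN !AD !AN.
by congr (_ - _); apply: comp_mod => //; exact: comp_mod.
Qed.

(** Alternating the two generators [S] and [T], which make the same elements
    invertible, turns [w] into [T - (S - w)]; starting at [0] this produces
    all the multiples of [S - T]. *)
Lemma stays_invertible_iter S T : N S -> N T ->
  stays_invertible S T -> stays_invertible T S ->
  forall n, stays_invertible S (- (n%:R *: (S - T))).
Proof.
move=> NS NT ST TS.
have ND' : N (S - T) by apply: ND => //; exact: N_opp.
have NnD n : N (- (n%:R *: (S - T))) by apply/N_opp/NZ.
elim=> [|n IH] u Nu Su.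
  apply: (@eq_invertible_mod idfun) => [h|]; last by exists idfun.
  by rewrite scale0r oppr0 !fctE addr0.
have -> : - (n.+1%:R *: (S - T)) = T - (S - - (n%:R *: (S - T))).
  by rewrite -natr1 scalerDl scale1r !opprD !opprK [RHS]addrC addrA (addrC (- S)).
apply: stays_invertible_sub => //; last exact: ST.
  by apply: ND => //; exact: N_opp.
move=> {Nu Su} u Nu /(TS _ Nu); exact: stays_invertible_sub.
Qed.

End InvertibilityModulo.

(** * Bounded operators and their quadratic forms *)

Section BoundedOperators.
Context {R : realType} {H : completeNormedModType R[i]}.
Variable dot : {dot H for conjC}.
Hypothesis hH : hilbert_dot dot.

Local Notation "r *r h" := (real_complex R r *: h) (at level 40).
Local Notation ip := (ip dot).
Local Notation n2 h := (ip h h).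

Lemma bounded_operator_n2 (T : H -> H) : bounded_operator T ->
  exists2 c : R, 0 < c & forall h, n2 (T h) <= c * n2 h.
Proof.
move=> [/linear_bundle[F ->] cF].
have /linear_bounded_continuous/linear_boundedP/pinfty_ex_gt0[r r0 Fr] := cF.
have rE : r = real_complex R (complex.Re r).
  by rewrite RRe_real//; apply: gtr0_real.
have r0' : 0 < complex.Re r by rewrite rE ltcR in r0.
exists (complex.Re r ^+ 2); first by rewrite exprn_gt0.
by move=> h; rewrite (le_normC hH) -?rE // ltW.
Qed.

Lemma n2_bounded_operator (T : H -> H) (c : R) : linear T ->
  (forall h, n2 (T h) <= c * n2 h) -> bounded_operator T.
Proof.
move=> lT Tc; split=> //; move: lT Tc => /linear_bundle[F ->] Fc.
apply: bounded_linear_continuous; apply/linear_boundedP.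
(* Taking [d >= 1] makes [d ^ 2 >= d], so no square root of [c] is needed. *)
pose d := Num.max c 1.
have Fd h : n2 (F h) <= d ^+ 2 * n2 h.
  apply: (le_trans (Fc h)); rewrite ler_wpM2r ?ip_ge0//.
  have d1 : 1 <= d by rewrite le_max lexx orbT.
  apply: (@le_trans _ _ d); first by rewrite le_max lexx.
  by rewrite expr2 ler_peMr// (le_trans ler01).
have d0 : 0 <= d by rewrite le_max ler01 orbT.
near=> r => h; apply: (@le_trans _ _ (real_complex R d * `|h|)).
  by rewrite -(le_normC hH) ?Fd.
rewrite ler_wpM2r//; near: r; apply: nbhs_pinfty_ge.
by rewrite realE ler0c d0.
Unshelve. all: by end_near. Qed.

(** Positivity of [C] at [h - K^-1 C h], the minimizer of the quadratic majorant
    of the form along the direction [C h]. *)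
Lemma positive_symmetric_n2 (C : H -> H) (K : R) : linear C -> 0 < K ->
  (forall h k, ip (C h) k = ip h (C k)) -> (forall h, 0 <= ip (C h) h) ->
  (forall h, ip (C h) h <= K * n2 h) ->
  forall h, n2 (C h) <= K * ip (C h) h.
Proof.
move=> /linear_bundle[F ->] K0 sC pC CK h.
have := pC (h - K^-1 *r F h); rewrite linearB linearZ/=.
have := CK (F h).
rewrite !(ipBl, ipBr, ipZl, ipZr) (sC (F h) h).
set a := ip (F (F h)) _; set b := ip (F h) (F h); set c := ip _ h => ab.
have -> : c - K^-1 * b - (K^-1 * b - K^-1 * (K^-1 * a)) =
  c - 2 * K^-1 * b + K^-1 * K^-1 * a by ring.
have Ki : 0 < K^-1 by rewrite invr_gt0.
have e : K * K^-1 = 1 by rewrite mulfV// gt_eqF.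
have := ler_wpM2l (ltW (mulr_gt0 Ki Ki)) ab; rewrite !mulrA -(mulrA K^-1 _ K).
rewrite (mulrC K^-1 K) e mulr1 => h1 h2.
have : 0 <= c - K^-1 * b by lra.
move=> /(ler_wpM2l (ltW K0)); rewrite mulr0 mulrBr mulrA e mul1r subr_ge0.
by [].
Qed.

Lemma bounded_ip_le (C : H -> H) : bounded_operator C ->
  exists2 K : R, 0 < K & forall h, ip (C h) h <= K * n2 h.
Proof.
move=> /bounded_operator_n2[c c0 Cc]; exists (c + 1) => [|h]; first by lra.
have := ip_le_mean dot (C h) h; have := Cc h; have := ip_ge0 dot h; nra.
Qed.

Lemma positive_operator_ip (A : H -> H) : positive_operator dot A ->
  forall h, 0 <= ip (A h) h.
Proof. by move=> pA h; have := pA h; rewrite lecE => /andP[]. Qed.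

Lemma adjoint_ip (T T' : H -> H) : is_adjoint dot T T' ->
  forall h k, ip (T h) k = ip h (T' k).
Proof. by move=> TT' h k; rewrite /ip TT'. Qed.

(** Polarization, with [h + i k]. *)
Lemma positive_operator_sym (A : H -> H) : linear A -> positive_operator dot A ->
  forall h k, ip (A h) k = ip h (A k).
Proof.
move=> /linear_bundle[F ->] pA h k.
have real x : complex.Im (dot (F x) x) = 0 by exact/ger0_Im/pA.
have := real (h + 'i%C *: k).
have -> : F (h + 'i%C *: k) = F h + 'i%C *: F k by rewrite linearD linearZ.
rewrite linearDl !linearDr /= !linearZl_LR/= !linearZr_LR/=.
rewrite (ipC _ h (F k)) /ip.
move: (real h) (real k).
case: (dot (F h) h) (dot (F k) k) (dot (F h) k) (dot (F k) h).
move=> a b [a1 b1] [c1 d1] [c2 d2] /= -> ->.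
rewrite /=; lra.
Qed.

End BoundedOperators.

(** * Well-supported positive operators *)

Section SpectralGap.
Context {R : realType} {H : completeNormedModType R[i]}.
Variable dot : {dot H for conjC}.
Hypothesis hH : hilbert_dot dot.
Variable M : set (H -> H).
Hypothesis hM : von_neumann_algebra dot M.

Local Notation "r *r h" := (real_complex R r *: h) (at level 40).
Local Notation ip := (ip dot).
Local Notation n2 h := (ip h h).

Lemma vna_linear T : M T -> linear T.
Proof. by move=> /(vna_bounded hM)[]. Qed.

Lemma vna_opp T : M T -> M (- T).
Proof. by move=> MT; rewrite -scaleN1r; exact: vna_scale hM _ _ MT. Qed.

Lemma vna_sub S T : M S -> M T -> M (S - T).
Proof. by move=> MS MT; apply: vna_add hM _ _ MS (vna_opp MT). Qed.

Lemma invertible_in_bounded_below T : invertible_in M T ->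
  exists2 c : R, 0 < c & forall h, n2 h <= c * n2 (T h).
Proof.
move=> [S MS [_ ST]].
have [c c0 Sc] := bounded_operator_n2 hH (vna_bounded hM MS).
exists c => // h; rewrite -[h in leLHS](congr1 (@^~ h) ST); exact: Sc.
Qed.

(** [0] lies outside the closed set [spectrum A \ 0], hence so does a
    neighbourhood of it. *)
Lemma well_supported_resolvent A : well_supported M A ->
  exists2 a : R, 0 < a & forall t, 0 < t < a ->
    invertible_in M (real_complex R t *: idfun - A).
Proof.
move=> wsA.
have : nbhs (0 : R[i]^o) (~` (spectrum M A `\ 0 : set R[i]^o)).
  apply: open_nbhs_nbhs; split; first exact: closed_openC.
  by move=> [_]; apply.
move=> /nbhs_ballP[e /= e0 eE].
have eR : e = real_complex R (complex.Re e).
  by rewrite RRe_real//; apply: gtr0_real.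
rewrite eR ltcR in e0.
exists (complex.Re e) => // t /andP[t0 ta].
apply: contrapT => nt; apply: (eE (real_complex R t)).
  by rewrite /ball/= sub0r normrN eR gtr0_norm ltcR.
by split => //= -[t00]; rewrite t00 ltxx in t0.
Qed.

(** The claim is [A ^ 2 - a A >= 0].  For [m > 0] not too large, the operator
    [A ^ 2 - a A + m] factors as [(A - t1) (A - t2)] with both roots in the gap
    [(0, a)] of the spectrum, hence it is bounded below; if it is also positive,
    then so is [A ^ 2 - a A + m - e] for some [e > 0]. *)
Lemma well_supported_gap A : M A -> positive_operator dot A ->
  well_supported M A ->
  exists2 a : R, 0 < a & forall h, a * ip (A h) h <= n2 (A h).
Proof.
move=> MA pA /well_supported_resolvent[a a0 inv_a]; exists a => // h.
have lA := vna_linear MA.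
have sA := positive_operator_sym lA pA.
have [AD AN AZ _] := linear_rules lA.
rewrite -subr_le0; move: h.
have completed_square h :
    a * ip (A h) h - n2 (A h) <= (a ^+ 2 / 4) * n2 h.
  have := ip_ge0 dot (A h - (a / 2) *r h).
  rewrite !(ipBl, ipBr, ipZl, ipZr) (ipC _ h (A h)); lra.
apply: (no_least_constant_le0 _ completed_square) => [h|m m0 pm].
  exact: ip_ge0.
have [ma|ma] := ltP (a ^+ 2 / 4) m.
  exists (m - a ^+ 2 / 4) => [|h]; first by rewrite subr_gt0.
  by have := completed_square h; lra.
(* The roots of [t ^ 2 - a t + m], real because [m <= a ^ 2 / 4]. *)
pose s := Num.sqrt (a ^+ 2 - 4 * m).
have s2 : s ^+ 2 = a ^+ 2 - 4 * m by rewrite sqr_sqrtr; lra.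
have s0 : 0 <= s by exact: sqrtr_ge0.
have sa : s < a by nra.
pose t1 := (a - s) / 2; pose t2 := (a + s) / 2.
have t1a : 0 < t1 < a by apply/andP; split; rewrite /t1; lra.
have t2a : 0 < t2 < a by apply/andP; split; rewrite /t2; lra.
have [c1 c10 C1] := invertible_in_bounded_below (inv_a _ t1a).
have [c2 c20 C2] := invertible_in_bounded_below (inv_a _ t2a).
pose F t := real_complex R t *: idfun - A.
have MF t : M (F t) by apply/vna_sub/MA/(vna_scale hM)/(vna_id hM).
have MQ : M (F t1 \o F t2) by exact: vna_comp hM _ _ _ _.
have FE t k : F t k = t *r k - A k by [].
have Fsym t k l : ip (F t k) l = ip k (F t l).
  by rewrite !FE ipBl ipBr ipZl ipZr sA.
have QE h : ip ((F t1 \o F t2) h) h = m * n2 h - (a * ip (A h) h - n2 (A h)).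
  rewrite /= Fsym !FE !(ipBl, ipBr, ipZl, ipZr) (ipC _ h (A h)).
  suff : t1 * t2 = m /\ t1 + t2 = a by move=> [<- <-]; ring.
  by split; rewrite /t1 /t2; lra.
have [K K0 QK] := bounded_ip_le hH (vna_bounded hM MQ).
have Q2 : forall h, n2 ((F t1 \o F t2) h) <= K * ip ((F t1 \o F t2) h) h.
  apply: positive_symmetric_n2 => //; first exact: vna_linear.
    move=> h k /=; rewrite Fsym Fsym; congr ip.
    rewrite !FE !AD !AN !AZ !scalerBr !opprD !opprK !scalerA mulrC.
    by rewrite !addrA [in LHS](addrAC _ (- (real_complex R t2 *: A k))).
  by move=> h; rewrite QE subr_ge0.
have d0 : 0 < c2 * c1 * K by rewrite !mulr_gt0.
exists (c2 * c1 * K)^-1 => [|h]; first by rewrite invr_gt0.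
rewrite ler_pdivrMl// -QE -!mulrA.
apply: (le_trans (C2 h)); rewrite ler_pM2l//.
apply: (le_trans (C1 _)); rewrite ler_pM2l//.
exact: Q2.
Qed.

End SpectralGap.

(** * Neumann series in a von Neumann algebra *)

Section NeumannSeries.
Context {R : realType} {H : completeNormedModType R[i]}.
Variable dot : {dot H for conjC}.
Hypothesis hH : hilbert_dot dot.
Variable M : set (H -> H).
Hypothesis hM : von_neumann_algebra dot M.

Local Notation "r *r h" := (real_complex R r *: h) (at level 40).
Local Notation ip := (ip dot).
Local Notation n2 h := (ip h h).

(** Schwarz for the real and imaginary parts separately, whence the
    non-optimal factor [2]. *)
Lemma norm_dot_le h k : `|dot h k| <= real_complex R (2 * Num.sqrt (n2 k)) * `|h|.
Proof.
have -> : `|h| = real_complex R (Num.sqrt (n2 h)).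
  apply/eqP; rewrite -(@eqrXn2 _ 2)// ?ler0c ?sqrtr_ge0// (normC_sqr hH).
  by rewrite -rmorphXn/= sqr_sqrtr ?ip_ge0.
rewrite normc_def -rmorphM lecR /=.
have ImE : complex.Im (dot h k) = - ip ('i%C *: h) k.
  by rewrite /ip linearZl_LR/=; case: (dot h k) => a b /=; lra.
rewrite -(@ler_sqr R) ?nnegrE ?sqrtr_ge0 ?mulr_ge0 ?sqrtr_ge0//.
rewrite !exprMn !sqr_sqrtr ?ip_ge0 ?addr_ge0 ?sqr_ge0// ImE sqrrN.
have := ip_sqr_le dot h k; have := ip_sqr_le dot ('i%C *: h) k.
rewrite n2_scale /= expr0n add0r expr1n mul1r -/(ip h k).
have := ip_ge0 dot h; have := ip_ge0 dot k; nra.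
Qed.

Lemma continuous_dotl k : continuous (dot^~ k : H -> R[i]^o).
Proof.
pose f : H -> R[i]^o := dot^~ k.
have lf : linear f by move=> a u v; rewrite /f linearDl/= linearZl_LR.
pose F := HB.pack_for {linear H -> R[i]^o} f
  (GRing.isLinear.Build _ _ _ _ f lf).
apply: (@bounded_linear_continuous _ _ _ F).
apply/linear_boundedP; near=> r => h; apply: le_trans (norm_dot_le h k) _.
rewrite ler_wpM2r//; near: r; apply: nbhs_pinfty_ge.
by rewrite realE ler0c mulr_ge0 ?sqrtr_ge0.
Unshelve. all: by end_near. Qed.

Section Contraction.
Variable K : H -> H.
Hypothesis MK : M K.
(* For the norm, as opposed to its square, the factor is [1/2]. *)
Hypothesis Kq : forall h, n2 (K h) <= 4^-1 * n2 h.

(** The partial sums of [1 - K + K ^ 2 - ...], in Horner form. *)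
Fixpoint neumann n : H -> H := if n is m.+1 then idfun - (K \o neumann m) else 0.

Lemma neumann_in n : M (neumann n).
Proof.
elim: n => [|n IH] /=.
  by rewrite -(scale0r idfun); exact/(vna_scale hM)/(vna_id hM).
exact: vna_sub hM _ _ (vna_id hM) (vna_comp hM MK IH).
Qed.

Let lK := vna_linear hM MK.

Lemma contraction_norm h : `|K h| <= 2^-1 * `|h|.
Proof.
have -> : 2^-1 = real_complex R 2^-1 by rewrite fmorphV rmorph_nat.
rewrite -(le_normC hH) ?invr_ge0//; apply: (le_trans (Kq h)).
by rewrite ler_wpM2r ?ip_ge0//; lra.
Qed.

Lemma neumann_step n h : `|neumann n.+1 h - neumann n h| <= 2^-1 ^+ n * `|h|.
Proof.
have [KD KN _ K0] := linear_rules lK.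
elim: n => [|n IH]; first by rewrite expr0 mul1r /= !fctE K0 !subr0.
rewrite -[X in `|X|]/((h - K (neumann n.+1 h)) - (h - K (neumann n h))).
rewrite opprB addrC addrA subrK -KN -KD.
apply: (le_trans (contraction_norm _)).
by rewrite distrC exprS -mulrA ler_wpM2l// invr_ge0.
Qed.

Lemma neumann_dist n k h :
  `|neumann n h - neumann (n + k) h| <= 2 * 2^-1 ^+ n * `|h|.
Proof.
suff : `|neumann n h - neumann (n + k) h| <=
    2 * (2^-1 ^+ n - 2^-1 ^+ (n + k)) * `|h|.
  move=> /le_trans; apply; rewrite ler_wpM2r// ler_wpM2l// gerBl.
  by rewrite exprn_ge0// invr_ge0.
elim: k => [|k IH]; first by rewrite addn0 !subrr normr0 mulr0 mul0r.
apply: (le_trans (ler_distD (neumann (n + k) h) _ _)).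
apply: (le_trans (lerD IH _)).
  by rewrite distrC addnS; exact: neumann_step.
rewrite -mulrDl ler_wpM2r// addnS exprS.
by rewrite le_eqVlt; apply/orP; left; apply/eqP; field.
Qed.

Lemma neumann_cvg h : cvg (neumann n h @[n --> \oo]).
Proof.
have hR : `|h| = real_complex R (complex.Re `|h|) by rewrite RRe_real.
apply/cauchy_cvgP/cauchy_exP => e e0.
have eR : e = real_complex R (complex.Re e).
  by rewrite RRe_real//; apply: gtr0_real.
rewrite eR ltcR in e0.
set a := complex.Re `|h| in hR; set b := complex.Re e in eR e0.
have [N ab] : exists N : nat, 2 * a < 2 ^+ N * b.
  exists (Num.truncn (2 * a / b)).+1; rewrite -ltr_pdivrMr//.
  apply: (lt_le_trans (truncnS_gt _)).
  by rewrite -natrX ler_nat ltnW// ltn_expl.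
exists (neumann N h); exists N => // n /= Nn; rewrite -ball_normE /=.
rewrite -(subnKC Nn); apply: (le_lt_trans (neumann_dist _ _ _)).
rewrite hR eR.
have -> : 2 * 2^-1 ^+ N * real_complex R a = real_complex R (2 * 2^-1 ^+ N * a).
  by rewrite !rmorphM rmorphXn fmorphV !rmorph_nat.
rewrite ltcR mulrAC exprVn ltr_pdivrMr ?exprn_gt0//.
by rewrite [ltRHS]mulrC.
Qed.

Lemma n2_fixed_eq0 y : K y = - y -> y = 0.
Proof.
move=> Ky; apply: (@ip_eq0 _ _ dot).
have := Kq y; rewrite Ky ipNl ipNr; have := ip_ge0 dot y; lra.
Qed.

(** The pointwise limit [V] of the partial sums solves [V h + K (V h) = h].
    Uniqueness of the solution makes [V] linear and a two-sided inverse; being a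
    limit of elements of [M] for the strong, hence for the weak operator
    topology, [V] is in [M]. *)
Lemma neumann_series : exists2 V, M V &
  (idfun + K) \o V = idfun /\ V \o (idfun + K) = idfun.
Proof.
have [KD KN KZ K0] := linear_rules lK.
pose V h := lim (neumann n h @[n --> \oo]).
have VE h : V h = h - K (V h).
  have nV : neumann n h @[n --> \oo] --> V h by exact: neumann_cvg.
  apply: (@cvg_unique _ (@norm_hausdorff _ H) (neumann n.+1 h @[n --> \oo])).
    by move: nV; rewrite -cvg_shiftS.
  apply: cvgB; first exact: cvg_cst.
  by apply: continuous_cvg nV; have [_] := vna_bounded hM MK; apply.
have KV h : K (V h) = h - V h by rewrite [in RHS]VE opprB addrC subrK.
have VU h y : y + K y = h -> y = V h.
  move=> yh; apply/eqP; rewrite -subr_eq0; apply/eqP/n2_fixed_eq0.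
  rewrite KD KN KV.
  have -> : K y = h - y by rewrite -yh addrAC subrr add0r.
  by rewrite addrC opprB addrA subrK opprB.
have lV : linear V.
  move=> a u v; apply/esym/VU; rewrite KD KZ addrACA -scalerDr.
  by rewrite !KV !(addrC (V _)) !subrK.
have Vb h : n2 (V h) <= 4 * n2 h.
  have := Kq (V h); have := ip_ge0 dot (2 *r h - V h).
  rewrite KV !(ipBl, ipBr, ipZl, ipZr) (ipC _ (V h) h); lra.
exists V.
  apply: (vna_wot_closed hM (F := neumann @ \oo)).
  - by exists 0 => // n _; exact: neumann_in.
  - exact: (n2_bounded_operator hH lV Vb).
  - move=> h k.
    apply: (@continuous_cvg _ _ _ _ _ (neumann^~ h) (dot^~ k : H -> R[i]^o)).
      exact: continuous_dotl.
    exact: neumann_cvg.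
split; apply/funext => h; apply/esym.
  by rewrite -[RHS]/(V h + K (V h)) KV addrC subrK.
exact: VU.
Qed.

End Contraction.

End NeumannSeries.

(** * The algebra of A-bounded operators *)

Section ABoundedOperators.
Context {R : realType} {H : completeNormedModType R[i]}.
Variable dot : {dot H for conjC}.
Hypothesis hH : hilbert_dot dot.
Variable M : set (H -> H).
Hypothesis hM : von_neumann_algebra dot M.
Variable A : H -> H.
Hypothesis AM : M A.
Hypothesis A_neq0 : A <> 0.
Hypothesis A_pos : positive_operator dot A.
Hypothesis A_ws : well_supported M A.

Local Notation "r *r h" := (real_complex R r *: h) (at level 40).
Local Notation ip := (ip dot).
Local Notation n2 h := (ip h h).
Local Notation sA h := (ip (A h) h).

Let linA : linear A := vna_linear hM AM.
Let A_sym : forall h k, ip (A h) k = ip h (A k) :=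
  positive_operator_sym linA A_pos.

Lemma A_form_ge0 h : 0 <= sA h.
Proof. exact: positive_operator_ip. Qed.

Lemma A_form_upper : exists2 K : R, 0 < K & forall h, n2 (A h) <= K * sA h.
Proof.
have [K K0 AK] := bounded_ip_le hH (vna_bounded hM AM).
by exists K => //; apply: positive_symmetric_n2 => //; exact: A_form_ge0.
Qed.

Lemma A_seminorm1_exists : exists g, sA g = 1.
Proof.
have [K K0 AK] := A_form_upper.
have [g g0] : exists g, 0 < sA g.
  apply: contrapT => /forallNP sA0; apply: A_neq0; apply/funext => h.
  apply: (@ip_eq0 _ _ dot); apply/eqP; rewrite eq_le ip_ge0 andbT.
  by apply: (le_trans (AK h)); rewrite pmulr_rle0// leNgt; exact/negP.
have [_ _ AZ _] := linear_rules linA.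
exists ((Num.sqrt (sA g))^-1 *r g); rewrite AZ ipZl ipZr mulrA -invfM -expr2.
by rewrite sqr_sqrtr ?ltW// mulVf// gt_eqF.
Qed.

(** Homogeneity reduces to vectors of seminorm [1], except on the kernel of the
    form, where the bound says that [T] preserves this kernel. *)
Lemma A_bounded_form T : A_bounded dot M A T ->
  exists2 c : R, 0 <= c & forall h, sA (T h) <= c * sA h.
Proof.
move=> [MT Tfin].
have [AD AN AZ _] := linear_rules linA.
have [TD TN TZ _] := linear_rules (vna_linear hM MT).
have [g g1] := A_seminorm1_exists.
have [c c0 Tc] : exists2 c : R, 0 <= c & forall h, sA h = 1 -> sA (T h) <= c.
  have ub h : sA h = 1 -> ((Num.sqrt (sA (T h)))%:E <= A_opnorm dot A T)%E.
    move=> h1; apply: ereal_sup_ubound; exists h => //=.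
    by rewrite /A_seminorm -/(ip _ _) h1 sqrtr1.
  case: (A_opnorm dot A T) Tfin ub => [c| |] // _ ub; last first.
    by have := ub _ g1; rewrite leNgt ltNyr.
  exists (c ^+ 2) => [|h /ub]; first exact: sqr_ge0.
  rewrite lee_fin => sc; rewrite -[leLHS]sqr_sqrtr ?A_form_ge0//.
  by rewrite ler_sqr// ?nnegrE ?sqrtr_ge0// (le_trans _ sc)// sqrtr_ge0.
exists c => // h; have [h0|h0] := eqVneq (sA h) 0.
  have [K K0 AK] := A_form_upper.
  have Ah0 : A h = 0.
    apply: (@ip_eq0 _ _ dot); apply/eqP; rewrite eq_le ip_ge0 andbT.
    by rewrite (le_trans (AK h))// h0 mulr0.
  (* All the [g + t h] have seminorm 1, so [T g + t T h] stays bounded as [t]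
     grows, which forces [T h] into the kernel of the form; adding the bounds
     for [t] and [- t] cancels the cross term. *)
  have gt1 t : sA (g + t *r h) = 1.
    rewrite AD AZ Ah0 scaler0 addr0 ipDr ipZr (A_sym g h) Ah0 (ipC _ g).
    by rewrite ip0l mulr0 addr0.
  rewrite h0 mulr0 leNgt; apply/negP => Th0.
  pose t := Num.sqrt ((c + 1) / sA (T h)).
  have t2 : t ^+ 2 * sA (T h) = c + 1.
    rewrite sqr_sqrtr ?divr_ge0 ?addr_ge0 ?(ltW Th0)// divfK// gt_eqF//.
  have := Tc _ (gt1 t); have := Tc _ (gt1 (- t)).
  rewrite !TD !TZ !AD !AZ !(ipDl, ipDr, ipZl, ipZr).
  have := A_form_ge0 (T g); move: t2; lra.
have {}h0 : 0 < sA h by rewrite lt_def h0 A_form_ge0.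
have := Tc ((Num.sqrt (sA h))^-1 *r h).
rewrite TZ !AZ !(ipZl, ipZr) !mulrA -invfM -expr2 (sqr_sqrtr (ltW h0)).
by rewrite mulVf ?gt_eqF// mulrC ler_pdivrMr//; apply.
Qed.

(** The forms [<A h, h>] and [|A h| ^ 2] are equivalent, by the upper bound for
    positive operators and the gap of the spectrum. *)
Lemma A_boundedP T : A_bounded dot M A T <->
  M T /\ exists2 c : R, 0 <= c & forall h, n2 (A (T h)) <= c * n2 (A h).
Proof.
have [a a0 Aa] := well_supported_gap hH hM AM A_pos A_ws.
have [K K0 AK] := A_form_upper.
split=> [bT|[MT [c c0 Tc]]].
  have [c c0 Tc] := A_bounded_form bT; split; first by have [] := bT.
  exists (K * c / a) => [|h]; first by rewrite !mulr_ge0// ?invr_ge0 ltW.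
  apply: (le_trans (AK _)); apply: (@le_trans _ _ (K * (c * sA h))).
    by rewrite ler_pM2l.
  rewrite -!mulrA ler_pM2l// ler_wpM2l// mulrC ler_pdivlMr// mulrC.
  exact: Aa.
split=> //; apply: (@le_lt_trans _ _ (Num.sqrt (c * K / a))%:E); last exact: ltry.
apply: ub_ereal_sup => _ [h /= h1 <-]; rewrite lee_fin ler_wsqrtr//.
have {}h1 : sA h = 1.
  rewrite -(sqr_sqrtr (A_form_ge0 h)).
  by move: h1; rewrite /A_seminorm -/(ip _ _) => ->; rewrite expr1n.
rewrite ler_pdivlMr// mulrC (le_trans (Aa _))// (le_trans (Tc h))//.
by rewrite ler_wpM2l// (le_trans (AK h))// h1 mulr1.
Qed.

Lemma A_bounded_linear T : A_bounded dot M A T -> linear T.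
Proof. by move=> [/(vna_linear hM)]. Qed.

Lemma A_bounded_id : A_bounded dot M A idfun.
Proof.
by apply/A_boundedP; split; [exact: vna_id hM|exists 1 => // h; rewrite mul1r].
Qed.

Lemma A_bounded_add X Y : A_bounded dot M A X -> A_bounded dot M A Y ->
  A_bounded dot M A (X + Y).
Proof.
move=> /A_boundedP[MX [c c0 Xc]] /A_boundedP[MY [d d0 Yd]].
apply/A_boundedP; split; first exact: vna_add hM _ _ MX MY.
have [AD _ _ _] := linear_rules linA.
exists (2 * c + 2 * d) => [|h]; first by rewrite addr_ge0 ?mulr_ge0.
rewrite -[X in A X]/(X h + Y h) AD !(ipDl, ipDr) (ipC _ (A (Y h))).
have := ip_le_mean dot (A (X h)) (A (Y h)); have := Xc h; have := Yd h; lra.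
Qed.

Lemma A_bounded_scale a X : A_bounded dot M A X -> A_bounded dot M A (a *: X).
Proof.
move=> /A_boundedP[MX [c c0 Xc]].
apply/A_boundedP; split; first exact: vna_scale hM _ _ MX.
have [_ _ AZ _] := linear_rules linA.
pose b := complex.Re a ^+ 2 + complex.Im a ^+ 2.
have b0 : 0 <= b by rewrite addr_ge0 ?sqr_ge0.
exists (b * c) => [|h]; first by rewrite mulr_ge0.
by rewrite -[X in A X]/(a *: X h) AZ n2_scale -mulrA ler_wpM2l.
Qed.

Lemma A_bounded_comp X Y : A_bounded dot M A X -> A_bounded dot M A Y ->
  A_bounded dot M A (X \o Y).
Proof.
move=> /A_boundedP[MX [c c0 Xc]] /A_boundedP[MY [d d0 Yd]].
apply/A_boundedP; split; first exact: vna_comp hM _ _ MX MY.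
exists (c * d) => [|h /=]; first by rewrite mulr_ge0.
by rewrite (le_trans (Xc _))// -mulrA ler_wpM2l.
Qed.

Lemma A_bounded_ker X h : A_bounded dot M A X -> A h = 0 -> A (X h) = 0.
Proof.
move=> /A_boundedP[_ [c _ Xc]] Ah; apply: (@ip_eq0 _ _ dot).
apply/eqP; rewrite eq_le ip_ge0 andbT.
by rewrite (le_trans (Xc h))// Ah ip0l mulr0.
Qed.

Lemma A_bounded_compA B : M B -> A_bounded dot M A (B \o A).
Proof.
move=> MB; have [b b0 Bb] := bounded_operator_n2 hH (vna_bounded hM MB).
have [a a0 Aa] := bounded_operator_n2 hH (vna_bounded hM AM).
apply/A_boundedP; split; first exact: vna_comp hM _ _ MB AM.
exists (a * b) => [|h /=]; first by rewrite mulr_ge0 ?ltW.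
by rewrite (le_trans (Aa _))// -mulrA ler_pM2l.
Qed.

(** The Neumann series provides an inverse [V] in [M]; it is [A]-bounded because
    [V = 1 - V B A], whose second term factors through [A]. *)
Lemma A_invertible_small B : M B ->
  (forall h, n2 (B (A h)) <= 4^-1 * n2 h) ->
  A_invertible dot M A (idfun + (B \o A)).
Proof.
move=> MB Bq; have ML : M (B \o A) by exact: vna_comp hM _ _ MB AM.
have [V MV [LV VL]] := neumann_series hH hM ML Bq.
have [VD _ _ _] := linear_rules (vna_linear hM MV).
exists V; last first.
  split; apply/funext => h /=.
    exact: (congr1 A (congr1 (@^~ h) LV)).
  exact: (congr1 A (congr1 (@^~ h) VL)).
have -> : V = idfun + (-1) *: ((V \o B) \o A).
  apply/funext => h; apply/eqP.
  rewrite -[X in _ == X]/(h + -1 *: V (B (A h))) scaleN1r -subr_eq opprK -VD.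
  exact/eqP/(congr1 (@^~ h) VL).
apply: A_bounded_add A_bounded_id _; apply/A_bounded_scale/A_bounded_compA.
exact: vna_comp hM _ _ MV MB.
Qed.

(** * Operators with the same A-spectra *)

Let N := A_bounded dot M A.

Lemma eq_A_invertible X Y : (forall h, A (X h) = A (Y h)) ->
  A_invertible dot M A X -> A_invertible dot M A Y.
Proof.
move=> XY; apply: (@eq_invertible_mod _ _ A N linA A_bounded_linear) => //.
exact: A_bounded_ker.
Qed.

Lemma A_spectrum_stays_invertible S T : N S -> N T ->
  (forall X, N X -> A_spectrum dot M A (S \o X) = A_spectrum dot M A (T \o X)) ->
  stays_invertible A N S T.
Proof.
move=> NS NT ST u Nu Su; apply: contrapT => nTu.
have [SD SN _ _] := linear_rules (A_bounded_linear NS).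
have [TD TN _ _] := linear_rules (A_bounded_linear NT).
have /ST e : N (- u) by rewrite -scaleN1r; exact: A_bounded_scale.
have : A_spectrum dot M A (T \o - u) 1.
  apply: contra_not nTu; apply: eq_A_invertible => h; congr (A _).
  by rewrite -[LHS]/(1 *: h - T (- u h)) scale1r TN opprK.
rewrite -e => /=; apply; apply: eq_A_invertible Su => h; congr (A _).
by rewrite -[RHS]/(1 *: h - S (- u h)) scale1r SN opprK.
Qed.

Lemma A_spectrum_subset S T X : N S -> N T -> (forall h, A (S h) = A (T h)) ->
  A_spectrum dot M A (S \o X) `<=` A_spectrum dot M A (T \o X).
Proof.
move=> NS NT ST l /= nS; apply: contra_not nS; apply: eq_A_invertible => h.
have [AD AN _ _] := linear_rules linA.
rewrite -[LHS]/(A (l *: h - T (X h))) -[RHS]/(A (l *: h - S (X h))).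
by rewrite !AD !AN ST.
Qed.

(** The Neumann series applies to [1 + S (t D' A)] only for small [t]; passing to
    the multiple [n (S - T)] compensates for [t], so that [m] is arbitrary. *)
Lemma A_invertible_positive_resolvent S T D' m : N S -> N T -> M D' ->
  stays_invertible A N S T -> stays_invertible A N T S -> 0 < m ->
  A_invertible dot M A
    (idfun - real_complex R m^-1 *: ((S - T) \o D' \o A)).
Proof.
move=> NS NT MD' ST TS m0.
have MSD : M (S \o D') by exact: (vna_comp hM (proj1 NS) MD').
have [c c0 Sc] := bounded_operator_n2 hH
  (vna_bounded hM (vna_comp hM MSD AM)).
(* With [t = 1 / (n m)], this [n] gives [t ^ 2 c <= 1 / 4]. *)
pose n := (Num.truncn (4 * c / m ^+ 2)).+1.
have n1 : 1 <= n%:R :> R by rewrite ler1n.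
have nc : 4 * c < n%:R * m ^+ 2.
  by rewrite -ltr_pdivrMr ?exprn_gt0//; exact: truncnS_gt.
have nm0 : 0 < n%:R * m by rewrite mulr_gt0.
pose t := (n%:R * m)^-1.
have t2c : t ^+ 2 * c <= 4^-1.
  rewrite exprVn mulrC ler_pdivrMr ?exprn_gt0// exprMn mulrC ler_pdivlMr//.
  rewrite mulrC (le_trans (ltW nc))// ler_wpM2r ?sqr_ge0// expr2 ler_peMr//.
pose u := real_complex R t *: (D' \o A).
have Nu : N u by apply/A_bounded_scale/A_bounded_compA.
have [_ _ SZ _] := linear_rules (A_bounded_linear NS).
have Su : A_invertible dot M A (idfun + (S \o u)).
  have -> : S \o u = (real_complex R t *: (S \o D')) \o A.
    by apply/funext => h; rewrite -[LHS]/(S (t *r D' (A h))) SZ.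
  apply: A_invertible_small => [|h]; first exact: (vna_scale hM _ MSD).
  rewrite -[X in ip X]/(t *r S (D' (A h))) ipZl ipZr mulrA -expr2.
  apply: (@le_trans _ _ (t ^+ 2 * (c * n2 h))).
    by rewrite ler_wpM2l ?sqr_ge0//; exact: Sc.
  by rewrite mulrA ler_wpM2r ?ip_ge0.
have := @stays_invertible_iter _ _ A N linA A_bounded_linear A_bounded_id
  A_bounded_add A_bounded_scale A_bounded_comp A_bounded_ker
  S T NS NT ST TS n u Nu Su.
apply: eq_A_invertible => h; congr (A _).
have [_ _ TZ _] := linear_rules (A_bounded_linear NT).
rewrite -[LHS]/(h - n%:R *: (S (t *r D' (A h)) - T (t *r D' (A h)))).
rewrite -[RHS]/(h - m^-1 *r (S (D' (A h)) - T (D' (A h)))).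
rewrite SZ TZ -scalerBr scalerA -(rmorph_nat (real_complex R)) -rmorphM.
by rewrite /t invfM mulrA mulfV ?mul1r// gt_eqF// ltr0n.
Qed.

(** Let [p h = |D' A h| ^ 2] and let [m] satisfy [p h <= m <A h, h>].  The
    operator [C = A (1 - m^-1 D D' A)] is positive with form [<A h, h> - m^-1 p h],
    and [A]-invertibility bounds [|A h|] by [|C h|], so the inequality has a gap:
    by the variational principle [p <= 0]. *)
Lemma positive_resolvent_eq0 D D' : M D -> M D' -> is_adjoint dot D D' ->
  (forall m, 0 < m ->
     A_invertible dot M A (idfun - real_complex R m^-1 *: (D \o D' \o A))) ->
  forall h, A (D h) = 0.
Proof.
move=> MD MD' /adjoint_ip DD' inv.
have [a a0 Aa] := well_supported_gap hH hM AM A_pos A_ws.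
have [K K0 AK] := A_form_upper.
have [d d0 Dd] := bounded_operator_n2 hH (vna_bounded hM MD').
have [AD AN AZ _] := linear_rules linA.
have p0 : forall h, n2 (D' (A h)) <= 0.
  apply: (@no_least_constant_le0 _ _ _ (fun h => sA h) (d * K)).
  - exact: A_form_ge0.
  - by move=> h; rewrite (le_trans (Dd _))// -mulrA ler_pM2l.
  move=> m m0 pm; pose B := idfun - real_complex R m^-1 *: (D \o D' \o A).
  have [V /A_boundedP[MV [c c0 Vc]] [_ VB]] := inv _ m0.
  pose C := A \o B.
  have MC : M C.
    apply: (vna_comp hM AM); apply: (vna_sub hM (vna_id hM)).
    exact: (vna_scale hM _ (vna_comp hM (vna_comp hM MD MD') AM)).
  have CE h k : ip (C h) k = ip (A h) k - m^-1 * ip (D' (A h)) (D' (A k)).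
    rewrite -[C h]/(A (h - m^-1 *r D (D' (A h)))) AD AN AZ ipBl ipZl.
    by rewrite (A_sym (D _)) DD'.
  have [k k0 Ck] := bounded_ip_le hH (vna_bounded hM MC).
  have C2 : forall h, n2 (C h) <= k * ip (C h) h.
    apply: positive_symmetric_n2 => //; first exact: (vna_linear hM).
      move=> h l; rewrite (ipC _ h (C l)) !CE (A_sym l) (ipC _ l).
      by rewrite (ipC _ (D' (A l))).
    by move=> h; rewrite CE subr_ge0 mulrC ler_pdivrMr// mulrC pm.
  have ck : 0 < (c + 1) * k by rewrite mulr_gt0// ltr_wpDl.
  exists (m * a / ((c + 1) * k)) => [|h]; first by rewrite divr_gt0// mulr_gt0.
  have low : a * sA h <= (c + 1) * k * ip (C h) h.
    apply: (le_trans (Aa h)); rewrite -[X in ip X X](congr1 (@^~ h) VB) /=.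
    apply: (le_trans (Vc (B h))); rewrite -mulrA.
    apply: (@le_trans _ _ ((c + 1) * n2 (C h))).
      by rewrite ler_wpM2r ?ip_ge0// lerDl.
    by rewrite ler_wpM2l ?addr_ge0.
  rewrite mulrAC ler_pdivrMr// -mulrA.
  have -> : m * sA h - n2 (D' (A h)) = m * ip (C h) h.
    by rewrite CE mulrBr mulrA mulfV ?mul1r// gt_eqF.
  by rewrite -mulrA ler_pM2l// [leRHS]mulrC.
move=> h; apply: (@ip_eq0 _ _ dot); rewrite A_sym DD'.
suff -> : D' (A (A (D h))) = 0 by rewrite ipC ip0l.
by apply: (@ip_eq0 _ _ dot); apply/eqP; rewrite eq_le p0 ip_ge0.
Qed.

End ABoundedOperators.

Theorem theorem3p4 (R : realType) (H : completeNormedModType R[i])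
    (dot : {dot H for conjC}) (hH : hilbert_dot dot)
    (M : set (H -> H)) (hM : von_neumann_algebra dot M)
    (A : H -> H) (AM : M A) (A_neq0 : A <> 0)
    (A_pos : positive_operator dot A) (A_ws : well_supported M A)
    (S T : H -> H) (hS : A_bounded dot M A S) (hT : A_bounded dot M A T) :
  (forall X : H -> H, A_bounded dot M A X ->
     A_spectrum dot M A (S \o X) = A_spectrum dot M A (T \o X))
  <-> A \o S = A \o T.
Proof.
split=> [specST|AST X NX].
  have MD : M (S - T) := vna_sub hM (proj1 hS) (proj1 hT).
  have [D' MD' DD'] := vna_adjoint hM MD.
  have AD : forall h, A ((S - T) h) = 0.
    apply: (positive_resolvent_eq0 hH hM AM A_neq0 A_pos A_ws MD MD' DD').
    move=> m m0; apply: A_invertible_positive_resolvent => //.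
      exact: A_spectrum_stays_invertible.
    by apply: A_spectrum_stays_invertible => // X NX; rewrite specST.
  apply/funext => h /=; apply/eqP; rewrite -subr_eq0; apply/eqP.
  have [addA oppA _ _] := linear_rules (vna_linear hM AM).
  by rewrite -oppA -addA; exact: AD.
have AST' h : A (S h) = A (T h) by exact: (congr1 (@^~ h) AST).
by apply/seteqP; split; apply: A_spectrum_subset.
Qed.
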